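(* Let $G$ be a Lie group, $H$ a closed subgroup of $G$, and $V$ a representation of $G$. Let $M_G(G/H,V)$ be the space of $G$-equivariant maps $G/H\to V$. Then $M_G(G/H,V)$ is precisely the space of maps $G/H\to V$ of the form $gH\mapsto gv$ with $v\in V^H$, and the assignment $v\mapsto (gH\mapsto gv)$ is a linear isomorphism $V^H\cong M_G(G/H,V)$.
   Context: Representations are over $\mathbb{F}=\mathbb{R}$ or $\mathbb{C}$. $G$ acts on $G/H$ by left translation. $M_G(G/H,V)=\{K:G/H\to V \mid K(gx)=gK(x)\ \text{for all } g\in G,\ x\in G/H\}$; no continuity, smoothness or integrability condition is imposed on the maps. $V^H=\{v\in V\mid hv=v\ \text{for all } h\in H\}$. *)

(* Defs.v *)
From HB Require Import structures.
From mathcomp Require Import all_boot all_order all_algebra.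
From mathcomp Require Import all_classical all_reals all_analysis.
From mathcomp Require Import complex.

Set Implicit Arguments.
Unset Strict Implicit.
Unset Printing Implicit Defensive.

Import Order.TTheory GRing.Theory Num.Theory.
Import numFieldNormedType.Exports.

Local Open Scope classical_set_scope.
Local Open Scope ring_scope.

Inductive base_field := RealField | ComplexField.

Definition scalars (R : realType) (k : base_field) : fieldType :=
  match k with RealField => R | ComplexField => R[i] end.

(* C^k on an open set U: all iterated partial derivatives of order at most k
   exist and are continuous at the points of U. The values of f outside U are
   irrelevant because U is open. *)
Fixpoint cont_diff (R : realType) (k n : nat) (U : set 'rV[R]_n)
    (f : 'rV[R]_n -> R) : Prop :=
  {in U, continuous f} /\
  match k with
  | 0%N => True
  | k'.+1 => forall i : 'I_n,
      {in U, forall x, derivable f x (delta_mx 0 i)} /\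
      cont_diff k' U (fun x => 'D_(delta_mx 0 i) f x)
  end.

Definition smooth_on (R : realType) (n m : nat) (U : set 'rV[R]_n)
    (f : 'rV[R]_n -> 'rV[R]_m) : Prop :=
  forall (k : nat) (j : 'I_m), cont_diff k U (fun x => f x 0 j).

(* A homeomorphism from an open set of M onto an open set of R^n. It and its
   inverse are represented by total functions, of which only the restrictions
   to chart_dom and to the image of chart_dom matter. *)
Record chart (R : realType) (n : nat) (M : topologicalType) := Chart {
  chart_dom : set M;
  chart_fun :> M -> 'rV[R]_n;
  chart_inv : 'rV[R]_n -> M;
  chart_dom_open : open chart_dom;
  chart_img_open : open (chart_fun @` chart_dom);
  chart_funK : {in chart_dom, cancel chart_fun chart_inv};
  chart_fun_continuous : {in chart_dom, continuous chart_fun};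
  chart_inv_continuous :
    {in chart_fun @` chart_dom, continuous chart_inv}
}.

Definition chart_img (R : realType) (n : nat) (M : topologicalType)
  (c : chart R n M) : set 'rV[R]_n := c @` chart_dom c.

Definition smooth_atlas (R : realType) (n : nat) (M : topologicalType)
    (A : set (chart R n M)) : Prop :=
  (forall x, exists2 c, A c & chart_dom c x) /\
  (forall c c', A c -> A c' ->
     smooth_on (c @` (chart_dom c `&` chart_dom c')) (c' \o chart_inv c)).

HB.mixin Record isTopologicalGroup G of Group G & Topological G := {
  mulg_continuous : continuous (fun z : G * G => (z.1 * z.2)%g);
  invg_continuous : continuous (fun x : G => (x^-1)%g)
}.

#[short(type="topologicalGroupType")]
HB.structure Definition TopologicalGroup :=
  {G of isTopologicalGroup G & Group G & Topological G}.

(* The smooth structure is the one generated by lie_atlas, and smoothness of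
   the group operations is read in the charts of lie_atlas, R^n x R^n being
   identified with R^(n + n). Dimension 0 is allowed. *)
HB.mixin Record isLieGroup (R : realType) G of TopologicalGroup G := {
  lie_dim : nat;
  lie_hausdorff : hausdorff_space G;
  lie_second_countable : @second_countable G;
  lie_atlas : set (chart R lie_dim G);
  lie_atlas_smooth : smooth_atlas lie_atlas;
  mulg_smooth : forall c1 c2 c3,
    lie_atlas c1 -> lie_atlas c2 -> lie_atlas c3 ->
    let mul (z : 'rV[R]_(lie_dim + lie_dim)) : G :=
      (chart_inv c1 (lsubmx z) * chart_inv c2 (rsubmx z))%g in
    smooth_on
      [set z | [/\ chart_img c1 (lsubmx z), chart_img c2 (rsubmx z)
                 & chart_dom c3 (mul z)]]
      (fun z => c3 (mul z));
  invg_smooth : forall c1 c2, lie_atlas c1 -> lie_atlas c2 ->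
    let inv (z : 'rV[R]_lie_dim) : G := ((chart_inv c1 z)^-1)%g in
    smooth_on [set z | chart_img c1 z /\ chart_dom c2 (inv z)]
      (fun z => c2 (inv z))
}.

#[short(type="lieGroupType")]
HB.structure Definition LieGroup (R : realType) :=
  {G of isLieGroup R G & TopologicalGroup G}.

Record representation (F : fieldType) (G : groupType) (V : lmodType F) :=
  Representation {
  rep_fun :> G -> {linear V -> V};
  rep1 : forall v, rep_fun 1%g v = v;
  repM : forall g h v, rep_fun (g * h)%g v = rep_fun g (rep_fun h v)
}.

Section CosetSpace.
Variables (G : groupType) (H : set G).

Definition left_coset (g : G) : set G := [set (g * h)%g | h in H].

Definition coset_space : Type := set_type (range left_coset).

Lemma left_coset_in (g : G) : left_coset g \in range left_coset.
Proof. by rewrite inE; exists g. Qed.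

Definition to_coset (g : G) : coset_space := SigSub (left_coset_in g).

Lemma translate_in (g : G) (x : coset_space) :
  [set (g * a)%g | a in val x] \in range left_coset.
Proof.
case: x => A /=; rewrite !inE => -[a _ <-]; exists (g * a)%g => //.
rewrite /left_coset image_comp; apply: eq_imagel => h _ /=.
by rewrite mulgA.
Qed.

Definition translate (g : G) (x : coset_space) : coset_space :=
  SigSub (translate_in g x).

End CosetSpace.

Section InvariantsAndEquivariantMaps.
Variables (F : fieldType) (G : groupType) (H : set G) (V : lmodType F).
Variable rho : representation G V.

Definition is_invariant (v : V) : Prop := forall h, H h -> rho h v = v.

Definition is_equivariant (K : coset_space H -> V) : Prop :=
  forall g x, K (translate g x) = rho g (K x).

Definition invariant_pred : {pred V} := fun v => `[< is_invariant v >].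

Lemma invariant_submod_closed : submod_closed invariant_pred.
Proof.
split=> [|a u v /asboolP hu /asboolP hv]; apply/asboolP => h Hh.
  by rewrite linear0.
by rewrite linearP hu// hv.
Qed.

HB.instance Definition _ :=
  GRing.isSubmodClosed.Build F V invariant_pred invariant_submod_closed.

Definition equivariant_pred : {pred coset_space H -> V} :=
  fun K => `[< is_equivariant K >].

Lemma equivariant_submod_closed : submod_closed equivariant_pred.
Proof.
split=> [|a K L /asboolP hK /asboolP hL]; apply/asboolP => g x.
  by rewrite [LHS]/= [in RHS]/GRing.zero/= linear0.
rewrite -[LHS]/(a *: K (translate g x) + L (translate g x)).
by rewrite -[(a *: K + L) x]/(a *: K x + L x) linearP hK hL.
Qed.

HB.instance Definition _ :=
  GRing.isSubmodClosed.Build F (coset_space H -> V) equivariant_pred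
    equivariant_submod_closed.

Record invariants := Invariants {
  invariant_val :> V;
  _ : invariant_val \in invariant_pred
}.
HB.instance Definition _ := [isSub for invariant_val].
HB.instance Definition _ := [Choice of invariants by <:].
HB.instance Definition _ := [SubChoice_isSubLmodule of invariants by <:].

Record equivariant_maps := EquivariantMaps {
  equivariant_val :> coset_space H -> V;
  _ : equivariant_val \in equivariant_pred
}.
HB.instance Definition _ := [isSub for equivariant_val].
HB.instance Definition _ := [Choice of equivariant_maps by <:].
HB.instance Definition _ :=
  [SubChoice_isSubLmodule of equivariant_maps by <:].

End InvariantsAndEquivariantMaps.

Arguments invariants {F G} H {V} rho.
Arguments equivariant_maps {F G} H {V} rho.
Arguments is_invariant {F G} H {V} rho v.
Arguments is_equivariant {F G} H {V} rho K.

(* Main.v *)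
(* An equivariant K satisfies K (gH) = g K (H), so it is determined by K (H),
   which is H-invariant because hH = H; evaluation at H is thus inverse to
   v |-> (gH |-> g v). *)
Require Import Defs.
From HB Require Import structures.
From mathcomp Require Import all_boot all_order all_algebra.
From mathcomp Require Import all_classical all_reals all_analysis.

Set Implicit Arguments.
Unset Strict Implicit.
Unset Printing Implicit Defensive.

Local Open Scope classical_set_scope.
Local Open Scope ring_scope.

(** [G] acts transitively on the cosets, so an equivariant map is fixed by its value at the base
    coset [H], and that value must be fixed by the stabiliser [H]. Conversely, for invariant [v] the
    vector [g v] depends only on [gH] ([orbit_mapE]), and the resulting map is equivariant.
    [is_equivariantP] combines both directions; [orbit_iso_linear] and [orbit_iso_bij] upgrade this
    to a linear isomorphism. *)

Section Cosets.
Variables (G : groupType) (H : set G).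

Lemma to_coset_surj (x : coset_space H) : exists g, to_coset H g = x.
Proof.
by case: x => A A_coset; have := A_coset; rewrite inE => -[g _ gH];
  exists g; apply: val_inj.
Qed.

Lemma translate_to_coset (g a : G) :
  translate g (to_coset H a) = to_coset H (g * a)%g.
Proof.
apply: val_inj; rewrite /= /left_coset image_comp.
by apply: eq_imagel => h _ /=; rewrite mulgA.
Qed.

Hypothesis H_group : group_closed (mem H).

(** Cosets are compared as subsets of [G]: since [1] is in [H], [g] lies in its own coset, hence in
    that of [g']. *)
Lemma to_coset_eq (g g' : G) :
  to_coset H g = to_coset H g' -> exists2 h, H h & g = (g' * h)%g.
Proof.
move=> /(congr1 val)/= eq_gg'.
have : left_coset H g g by exists 1%g; [exact: set_mem H_group.1 | rewrite mulg1].
by rewrite eq_gg' => -[h Hh <-]; exists h.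
Qed.

Lemma to_coset1 (h : G) : H h -> to_coset H h = to_coset H 1%g.
Proof.
move=> /mem_set Hh; apply: val_inj; apply/seteqP; split=> _ [a /mem_set Ha <-].
  exists (h * a)%g; last by rewrite mul1g.
  by apply: set_mem; exact: group_closedM Ha.
exists (h^-1 * a)%g; last by rewrite mulgA mulgV.
by apply: set_mem; apply: group_closedM => //; exact: group_closedV Hh.
Qed.

End Cosets.

Section OrbitMaps.
Variables (F : fieldType) (G : groupType) (H : set G) (V : lmodType F).
Variable rho : representation G V.
Hypothesis H_group : group_closed (mem H).

(** A coset is a bare subset, so a representative is chosen once and for all; [orbit_map v] is
    independent of this choice when [v] is invariant. *)
Definition coset_rep (x : coset_space H) : G := sval (cid (to_coset_surj x)).

Lemma coset_repK : cancel coset_rep (to_coset H).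
Proof. by move=> x; rewrite /coset_rep; case: cid. Qed.

Definition orbit_map (v : V) (x : coset_space H) : V := rho (coset_rep x) v.

(** The chosen representative of [gH] is [g * h] with [h] in [H], and [v] absorbs [h]. *)
Lemma orbit_mapE (v : V) (g : G) :
  is_invariant H rho v -> orbit_map v (to_coset H g) = rho g v.
Proof.
move=> v_inv.
have [h Hh] := to_coset_eq H_group (coset_repK (to_coset H g)).
by rewrite /orbit_map => ->; rewrite repM v_inv.
Qed.

Lemma is_equivariantP (K : coset_space H -> V) :
  is_equivariant H rho K <->
  exists2 v, is_invariant H rho v & forall g, K (to_coset H g) = rho g v.
Proof.
split=> [K_equi | [v _ KE] g x]; last first.
  by have [a <-] := to_coset_surj x; rewrite translate_to_coset !KE repM.
have KE g : K (to_coset H g) = rho g (K (to_coset H 1%g)).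
  by rewrite -K_equi translate_to_coset mulg1.
(* Invariance of this value: [rho h] sends it to [K (hH)], and [hH = H]. *)
exists (K (to_coset H 1%g)) => // h Hh.
by rewrite -KE to_coset1.
Qed.

Lemma invariants_inv (v : invariants H rho) :
  is_invariant H rho (invariant_val v).
Proof. by apply/asboolP; exact: (valP v). Qed.

Lemma orbit_map_equivariant (v : invariants H rho) :
  orbit_map v \in equivariant_pred (H := H) rho.
Proof.
apply/asboolP/is_equivariantP; exists (invariant_val v) => [|g].
  exact: invariants_inv.
by apply: orbit_mapE; exact: invariants_inv.
Qed.

Definition orbit_iso (v : invariants H rho) : equivariant_maps H rho :=
  EquivariantMaps (orbit_map_equivariant v).

(** At each coset [x], the value is the single linear operator [rho (coset_rep x)] applied to the
    vector. *)
Lemma orbit_iso_linear : linear orbit_iso.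
Proof.
by move=> a u v; apply: val_inj; apply/funext => x; exact: GRing.linearP.
Qed.

Lemma orbit_isoE (v : invariants H rho) (g : G) :
  orbit_iso v (to_coset H g) = rho g (invariant_val v).
Proof. by apply: orbit_mapE; exact: invariants_inv. Qed.

Lemma eval1_invariant (K : equivariant_maps H rho) :
  K (to_coset H 1%g) \in invariant_pred H rho.
Proof.
have /asboolP/is_equivariantP[v v_inv KE] := valP K.
by apply/asboolP; rewrite KE rep1.
Qed.

Lemma orbit_iso_bij : bijective orbit_iso.
Proof.
(* The inverse is evaluation at the base coset. *)
exists (fun K => Invariants (eval1_invariant K)) => [v | K].
  by apply: val_inj; rewrite [LHS]orbit_isoE rep1.
apply: val_inj; apply/funext => x; have [g <-] := to_coset_surj x.
have /asboolP K_equi := valP K.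
by rewrite [LHS]orbit_isoE /= -K_equi translate_to_coset mulg1.
Qed.

End OrbitMaps.

Theorem theorem2p5 (R : realType) (k : base_field) (G : lieGroupType R)
    (H : set G) (V : lmodType (scalars R k)) (rho : representation G V) :
  group_closed (mem H) -> closed H ->
  [set K | is_equivariant H rho K] =
    [set K | exists2 v, is_invariant H rho v &
                        forall g, K (to_coset H g) = rho g v] /\
  exists Phi : {linear invariants H rho -> equivariant_maps H rho},
    bijective Phi /\
    forall (v : invariants H rho) (g : G),
      equivariant_val (Phi v) (to_coset H g) = rho g (invariant_val v).
Proof.
move=> H_group _; split.
  by apply/seteqP; split=> K /= /(is_equivariantP rho H_group).
pose Phi : {linear invariants H rho -> equivariant_maps H rho} :=
  HB.pack (orbit_iso (rho := rho) H_group)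
    (GRing.isLinear.Build _ _ _ _ _ (orbit_iso_linear (rho := rho) H_group)).
exists Phi; split; first exact: orbit_iso_bij.
exact: orbit_isoE.
Qed.
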